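(* Let $n\geq 1$. For any compact subset $K$ of $\mathbb{R}^n$, any $\varepsilon>0$ and any function $f$ in $C(K)$, there exist $c_1,\ldots,c_N$ in $\mathbb{R}$ and $a_1,\ldots,a_N$ in $\mathbb{R}^n$ such that \[ \left\| f-\sum_{j=1}^N c_j e^{-\|x-a_j\|_{\mathbb{R}^n}^2}\right\|_{\infty,K}<\varepsilon , \] where the norm is taken of the expression as a function of $x\in K$.
   Context: $C(K)$ is the Banach algebra of all real-valued continuous functions on $K$, $\|f\|_{\infty,K}=\sup_{x\in K}|f(x)|$, and $\|\cdot\|_{\mathbb{R}^n}$ is the Euclidean norm on $\mathbb{R}^n$. *)

(* Defs.v *)
From mathcomp Require Import all_boot all_order all_algebra.
From mathcomp Require Import all_classical all_reals all_analysis.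

Set Implicit Arguments.
Unset Strict Implicit.
Unset Printing Implicit Defensive.

Import Order.TTheory GRing.Theory Num.Theory.
Import numFieldNormedType.Exports.

Local Open Scope classical_set_scope.
Local Open Scope ring_scope.

(* The norm that the library puts on row vectors is the max norm, which induces
   the same topology but is not the norm in the Gaussians. *)
Definition euclid_norm (R : realType) (n : nat) (x : 'rV[R]_n) : R :=
  Num.sqrt (\sum_(i < n) x ord0 i ^+ 2).

(* [sup set0 = 0], so this is 0 when [K] is empty, as it should be in C(set0).
   On a set without upper bound [sup] is also 0; [le_sup_norm] shows that this
   does not happen for a function continuous on a compact set. *)
Definition sup_norm (R : realType) (T : Type) (K : set T) (g : T -> R) : R :=
  sup [set `|g x| | x in K].

Lemma le_sup_norm (R : realType) (T : topologicalType) (K : set T)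
    (g : T -> R) (x : T) :
  compact K -> {within K, continuous g} -> K x -> `|g x| <= sup_norm K g.
Proof.
move=> cK cg Kx.
have /compact_bounded[M [_ Mg]] := continuous_compact cg cK.
apply: ub_le_sup; last by exists x.
exists (M + 1) => _ [y Ky <-].
by apply: (Mg (M + 1)); [rewrite ltrDl | exists y].
Qed.

(* Main.v *)
(** Since [e^{-|x - b/2|^2} = e^{-|b/2|^2} e^{-|x|^2} e^{<b, x>}], the span of the
    Gaussians is [e^{-|x|^2}] times the span of the exponentials [e^{<b, x>}].
    The latter is an algebra that contains the constants and separates points,
    so by Stone-Weierstrass it approximates [f(x) e^{|x|^2}] uniformly on [K];
    multiplying by [e^{-|x|^2} <= 1] does not increase the error. *)
Require Import Defs.
From mathcomp Require Import all_boot all_order all_algebra.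
From mathcomp Require Import all_classical all_reals all_analysis.
From mathcomp Require Import ring lra.

Import Order.TTheory GRing.Theory Num.Theory.
Import numFieldNormedType.Exports.

Local Open Scope classical_set_scope.
Local Open Scope ring_scope.

(** * Compactness as an induction principle, in place of finite subcovers *)

(* If [Q K] failed, the sets [S] with [Q (K `\` S)] would form a proper filter
   containing [K], without cluster point in [K]. *)
Lemma compact_set_ind (T : topologicalType) (K : set T) (Q : set T -> Prop) :
  compact K -> Q set0 ->
  (forall S S', S `<=` S' -> Q S' -> Q S) ->
  (forall S S', Q S -> Q S' -> Q (S `|` S')) ->
  (forall x, K x -> exists2 U, nbhs x U & Q (K `&` U)) ->
  Q K.
Proof.
move=> cK Q0 Qsub QU Qloc; apply: contrapT => nQK.
pose F : set_system T := [set S | Q (K `\` S)].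
have FF : ProperFilter F.
  split; first by rewrite /F /= setD0.
  split; first by rewrite /F /= setDT.
  - by move=> S S' FS FS'; rewrite /F /= setDIr; exact: QU.
  - by move=> S S' SS'; apply: Qsub; exact: setDS.
have [|x [Kx clx]] := cK F FF; first by rewrite /F /= setDv.
have [U xU QKU] := Qloc x Kx.
have FU : F (~` U) by rewrite /F /= setDE setCK.
by have [y [nUy Uy]] := clx _ _ FU xU.
Qed.

(** * Polynomial approximation of the absolute value *)

(* Newton-like iteration for the square root of [t ^+ 2]; its iterates are
   polynomials in [t] that increase to [`|t|] when [`|t| <= 1]. *)
Definition abs_iter {R : realType} (k : nat) (t : R) : R :=
  iter k (fun p => p + (t ^+ 2 - p ^+ 2) / 2) 0.

(** The contraction factor degenerates as [t] tends to 0, but the error starts at [|t|]. The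
    invariant [d <= 2|t| / (2 + k|t|)], kept without division, balances the two and gives the rate
    [2 / k] uniformly in [t]. *)
Lemma abs_iter_error {R : realType} (k : nat) (t : R) :
  `|t| <= 1 -> 0 <= `|t| - abs_iter k t /\ (`|t| - abs_iter k t) * k%:R <= 2.
Proof.
move=> t1.
(* With [d = `|t| - p], one step gives [d' <= d (1 - `|t| / 2)]. *)
suff [p0 d0 dk] : [/\ 0 <= abs_iter k t, 0 <= `|t| - abs_iter k t &
    (`|t| - abs_iter k t) * (2 + k%:R * `|t|) <= 2 * `|t|].
  split=> //; have [t0|t0] := eqVneq `|t| 0.
    by rewrite (_ : _ - _ = 0) ?mul0r//; lra.
  have tgt0 : 0 < `|t| by rewrite lt_def t0 normr_ge0.
  by rewrite -(ler_pM2r tgt0) -mulrA; nra.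
elim: k => [|k [p0 d0 dk]].
  by split; rewrite /= ?subr0 ?normr_ge0 ?mul0r ?addr0 // mulrC.
rewrite /= -/(abs_iter k t) -(real_normK (num_real t)) -[k.+1%:R]natr1.
set s := `|t| in t1 d0 dk *; set p := abs_iter k t in p0 d0 dk *.
have s0 : 0 <= s by exact: normr_ge0.
have k0 : 0 <= k%:R :> R by exact: ler0n.
have ks0 : 0 <= k%:R * s by exact: mulr_ge0.
have dE : s - (p + (s ^+ 2 - p ^+ 2) / 2) = (s - p) * (1 - (s + p) / 2) by field.
split.
- by rewrite addr_ge0// divr_ge0// subr_sqr mulr_ge0//; lra.
- by rewrite dE mulr_ge0//; lra.
- rewrite dE; apply: le_trans dk; rewrite -mulrA; apply: ler_wpM2l => //.
  (* Dropping [p >= 0] leaves a product equal to [2 + k s - (k + 1) s^2 / 2]. *)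
  apply: (@le_trans _ _ ((1 - s / 2) * (2 + (k%:R + 1) * s))).
    by apply: ler_wpM2r; [nra|lra].
  have : 0 <= k%:R * s * s by exact: mulr_ge0.
  nra.
Qed.

(** * The Stone-Weierstrass theorem on a compact set *)

Section StoneWeierstrass.
Context {R : realType} {T : topologicalType} (K : set T) (A : set (T -> R)).
Hypotheses (compactK : compact K)
  (contA : forall g, A g -> {within K, continuous g})
  (cstA : forall c, A (fun=> c))
  (addA : forall g h, A g -> A h -> A (fun x => g x + h x))
  (mulA : forall g h, A g -> A h -> A (fun x => g x * h x)).

(** Absolute values, maxima and minima may lead out of [A], so the lattice argument runs in its
    uniform closure on [K]. *)
Definition uclosure : set (T -> R) :=
  [set g | forall e, 0 < e ->
    exists2 h, A h & forall x, K x -> `|g x - h x| <= e].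

Lemma bounded_within (g : T -> R) : {within K, continuous g} ->
  exists2 M, 0 < M & forall x, K x -> `|g x| <= M.
Proof.
move=> cg; have [M [_ Mg]] := compact_bounded (continuous_compact cg compactK).
exists (`|M| + 1); first by rewrite ltr_wpDl.
move=> x Kx; apply: (Mg (`|M| + 1)); last by exists x.
by rewrite (le_lt_trans (ler_norm _))// ltrDl.
Qed.

Lemma subset_uclosure : A `<=` uclosure.
Proof.
by move=> g Ag e e0; exists g => // x _; rewrite subrr normr0 ltW.
Qed.

Lemma uclosureD (g h : T -> R) : uclosure g -> uclosure h ->
  uclosure (fun x => g x + h x).
Proof.
move=> cg ch e e0; have e2 : 0 < e / 2 by lra.
have [g' Ag gg'] := cg _ e2; have [h' Ah hh'] := ch _ e2.
exists (fun x => g' x + h' x); first exact: addA.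
move=> x Kx; rewrite opprD addrACA (splitr e).
by rewrite (le_trans (ler_normD _ _))// lerD ?gg' ?hh'.
Qed.

Lemma uclosureZ (c : R) (g : T -> R) : uclosure g ->
  uclosure (fun x => c * g x).
Proof.
move=> cg e e0.
have [|g' Ag gg'] := cg (e / (`|c| + 1)); first by rewrite divr_gt0// ltr_wpDl.
exists (fun x => c * g' x); first exact: mulA (cstA c) Ag.
move=> x Kx; rewrite -mulrBr normrM.
rewrite (@le_trans _ _ ((`|c| + 1) * `|g x - g' x|))//.
  by rewrite ler_wpM2r// lerDl.
by rewrite mulrC -ler_pdivlMr ?ltr_wpDl ?gg'.
Qed.

Lemma abs_iterA (k : nat) (g : T -> R) : A g -> A (fun x => abs_iter k (g x)).
Proof.
move=> Ag; elim: k => [|k IH]; first exact: cstA.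
rewrite [X in A X](_ : _ = fun x => abs_iter k (g x) +
    2^-1 * (g x * g x + (-1) * (abs_iter k (g x) * abs_iter k (g x)))); last first.
  by apply/funext => x /=; rewrite -/(abs_iter k (g x)); field.
by do ![exact: cstA | exact: Ag | exact: IH | apply: addA | apply: mulA].
Qed.

(** An approximant [h] from [A] is scaled by a bound [M] into [[-1, 1]], where the polynomials
    [abs_iter k] approximate the absolute value. *)
Lemma uclosure_norm (g : T -> R) : uclosure g -> uclosure (fun x => `|g x|).
Proof.
move=> cg e e0; have e2 : 0 < e / 2 by lra.
have [h Ah gh] := cg _ e2.
have [M M0 hM] := bounded_within _ (contA _ Ah).
(* Scaling back turns the error [2 / k] into [2 M / k], which has to be at most [e / 2]. *)
pose k := Num.bound (4 * M / e).
have kM : 4 * M / e < k%:R.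
  by apply: archi_boundP; rewrite divr_ge0 ?mulr_ge0 ?ltW.
exists (fun x => M * abs_iter k (M^-1 * h x)).
  exact: mulA (cstA M) (abs_iterA _ _ (mulA _ _ (cstA M^-1) Ah)).
move=> x Kx; set t := M^-1 * h x.
have t1 : `|t| <= 1.
  by rewrite normrM gtr0_norm ?invr_gt0// mulrC ler_pdivrMr// mul1r hM.
have [d0 dk] := abs_iter_error k t t1.
have hE : `|h x| = M * `|t|.
  by rewrite normrM gtr0_norm ?invr_gt0// mulrA divff ?mul1r ?gt_eqF.
rewrite (_ : _ - _ = (`|g x| - `|h x|) + M * (`|t| - abs_iter k t)); last first.
  by rewrite hE; ring.
rewrite (splitr e) (le_trans (ler_normD _ _))// lerD//.
  exact: le_trans (ler_dist_dist _ _) (gh x Kx).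
rewrite ger0_norm ?mulr_ge0 ?(ltW M0)//.
move: kM; rewrite ltr_pdivrMr// => /ltW/(ler_wpM2l d0) kM.
have := ler_wpM2r (ltW e0) dk; lra.
Qed.

Lemma uclosure_max (g h : T -> R) : uclosure g -> uclosure h ->
  uclosure (fun x => Num.max (g x) (h x)).
Proof.
move=> cg ch.
rewrite [X in uclosure X](_ : _ = fun x => 2^-1 * (g x + h x +
    `|g x + (-1) * h x|)); last first.
  by apply/funext => x; rewrite maxr_absE mulN1r mulrC.
by apply/uclosureZ/uclosureD; [exact: uclosureD |
  apply/uclosure_norm/uclosureD => //; exact: uclosureZ].
Qed.

Lemma uclosure_min (g h : T -> R) : uclosure g -> uclosure h ->
  uclosure (fun x => Num.min (g x) (h x)).
Proof.
move=> cg ch.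
rewrite [X in uclosure X](_ : _ = fun x => (-1) * Num.max ((-1) * g x)
    ((-1) * h x)); last first.
  by apply/funext => x; rewrite !mulN1r oppr_max !opprK.
by apply/uclosureZ/uclosure_max; exact: uclosureZ.
Qed.

Lemma nbhs_within_lt (g h : T -> R) (x : T) :
  {within K, continuous g} -> {within K, continuous h} -> K x -> g x < h x ->
  exists2 U, nbhs x U & forall z, (K `&` U) z -> g z < h z.
Proof.
move=> /subspace_continuousP cg /subspace_continuousP ch Kx gh.
have := cvgr_gt _ (cvgB (ch x Kx) (cg x Kx)) 0.
rewrite subr_gt0 => /(_ _ _ gh); rewrite near_withinE => U.
eexists; first exact: U.
by move=> z [Kz /(_ Kz)]; rewrite /= subr_gt0.
Qed.

Hypothesis sepA : forall x y, K x -> K y -> x <> y ->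
  exists2 g, A g & g x <> g y.

(** An affine function of a separating [g] takes any two prescribed values. *)
Lemma interpolateA (f : T -> R) (x y : T) : K x -> K y ->
  exists g, [/\ A g, g x = f x & g y = f y].
Proof.
move=> Kx Ky; have [<-|xy] := pselect (x = y).
  by exists (fun=> f x); split=> //; exact: cstA.
have [g Ag gxy] := sepA _ _ Kx Ky xy.
have d0 : g x - g y != 0 by rewrite subr_eq0; apply/eqP.
exists (fun z => f y + (f x - f y) / (g x - g y) * (g z + - g y)); split.
- exact: addA (cstA _) (mulA _ _ (cstA _) (addA _ _ Ag (cstA _))).
- by rewrite divfK//; ring.
- by rewrite subrr mulr0 addr0.
Qed.

Section Approximation.
Variables (f : T -> R) (contf : {within K, continuous f}).

Let contfD (c : R) : {within K, continuous (fun x => f x + c)}.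
Proof. by move=> x; apply: cvgD; [exact: contf|exact: cvg_cst]. Qed.

(** An interpolant of [f] at [x] and [y] lies above [f - e / 2] near [y]. Maxima of such functions
    cover [K] and keep the value at [x] small. *)
Lemma approx_above (x : T) (e : R) : 0 < e -> K x ->
  exists g, [/\ A g, g x < f x + e & forall z, K z -> f z - e < g z].
Proof.
move=> e0 Kx; have e2 : 0 < e / 2 by lra.
(* The other [e / 2] pays for the return from the closure to [A], whose members are known to be
   continuous. *)
suff [g [cg gx gK]] : exists g, [/\ uclosure g, g x < f x + e / 2 &
    forall z, K z -> f z - e / 2 < g z].
  have [h Ah gh] := cg _ e2.
  exists h; split=> // [|z Kz].
    by have := gh x Kx; rewrite ler_norml => /andP[? ?]; lra.
  by have := gh z Kz; have := gK z Kz; rewrite ler_norml => ? /andP[? ?]; lra.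
apply: (compact_set_ind _ _ (fun S => exists g, [/\ uclosure g,
    g x < f x + e / 2 & forall z, S z -> f z - e / 2 < g z])) => //.
- exists (fun=> f x); split=> //; first exact/subset_uclosure/cstA.
  by rewrite ltrDl.
- by move=> S S' SS' [g [cg gx gS]]; exists g; split=> // z /SS'; exact: gS.
- move=> S S' [g [cg gx gS]] [h [ch hx hS]].
  exists (fun z => Num.max (g z) (h z)); split; first exact: uclosure_max.
    by rewrite gt_max gx hx.
  by move=> z [/gS|/hS] fz; rewrite lt_max fz ?orbT.
- move=> y Ky; have [g [Ag gx gy]] := interpolateA f x y Kx Ky.
  have [|U yU fU] := nbhs_within_lt _ _ y (contfD (- (e / 2))) (contA _ Ag) Ky.
    by rewrite gy; lra.
  exists U => //; exists g; split=> //; first exact: subset_uclosure.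
  by rewrite gx ltrDl.
Qed.

(** Dually, a function from [approx_above] at [x] stays below [f + e / 2] near [x] by continuity;
    minima extend this to [K] and preserve the lower bound. *)
Theorem stone_weierstrass (e : R) : 0 < e ->
  exists2 g, A g & forall x, K x -> `|f x - g x| <= e.
Proof.
move=> e0; have e2 : 0 < e / 2 by lra.
suff [g [cg gl gu]] : exists g, [/\ uclosure g,
    forall z, K z -> f z - e / 2 < g z & forall z, K z -> g z < f z + e / 2].
  have [h Ah gh] := cg _ e2; exists h => // x Kx.
  have := gh x Kx; have := gl x Kx; have := gu x Kx.
  by rewrite !ler_norml => ? ? /andP[? ?]; apply/andP; split; lra.
apply: (compact_set_ind _ _ (fun S => exists g, [/\ uclosure g,
    forall z, K z -> f z - e / 2 < g z & forall z, S z -> g z < f z + e / 2])) => //.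
(* Even for the empty set the lower bound is required on all of [K], so some function from
   [approx_above] is taken. *)
- have [[x Kx]|K0] := pselect (K !=set0).
    have [g [Ag _ gK]] := approx_above x _ e2 Kx.
    by exists g; split=> //; exact: subset_uclosure.
  exists (fun=> 0); split=> //; first exact/subset_uclosure/cstA.
  by move=> z Kz; case: K0; exists z.
- by move=> S S' SS' [g [cg gx gS]]; exists g; split=> // z /SS'; exact: gS.
- move=> S S' [g [cg gx gS]] [h [ch hx hS]].
  exists (fun z => Num.min (g z) (h z)); split; first exact: uclosure_min.
    by move=> z Kz; rewrite lt_min gx ?hx.
  by move=> z [/gS|/hS] fz; rewrite gt_min fz ?orbT.
- move=> x Kx; have [g [Ag gx gK]] := approx_above x _ e2 Kx.
  have [U xU fU] := nbhs_within_lt _ _ x (contA _ Ag) (contfD (e / 2)) Kx gx.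
  by exists U => //; exists g; split=> //; exact: subset_uclosure.
Qed.

End Approximation.
End StoneWeierstrass.

(** * The algebra of exponential sums *)

Definition exp_sum {R : realType} {n : nat} (s : seq (R * 'rV[R]_n))
    (x : 'rV[R]_n) : R :=
  \sum_(p <- s) p.1 * expR (\sum_(i < n) p.2 ord0 i * x ord0 i).

Lemma exp_sumD (R : realType) (n : nat) (s t : seq (R * 'rV[R]_n)) x :
  exp_sum (s ++ t) x = exp_sum s x + exp_sum t x.
Proof. exact: big_cat. Qed.

Lemma exp_sumM (R : realType) (n : nat) (s t : seq (R * 'rV[R]_n)) x :
  exp_sum [seq (p.1 * q.1, p.2 + q.2) | p <- s, q <- t] x =
  exp_sum s x * exp_sum t x.
Proof.
rewrite /exp_sum big_allpairs_dep mulr_suml; apply: eq_bigr => p _.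
rewrite mulr_sumr; apply: eq_bigr => q _ /=.
under eq_bigr do rewrite mxE mulrDl.
by rewrite big_split/= expRD mulrACA.
Qed.

Lemma exp_sum_cst (R : realType) (n : nat) (c : R) (x : 'rV[R]_n) :
  exp_sum [:: (c, 0)] x = c.
Proof.
rewrite /exp_sum big_seq1 big1 ?expR0 ?mulr1// => i _.
by rewrite mxE mul0r.
Qed.

Lemma continuous_sum (R : realType) (T : topologicalType) (I : Type)
    (s : seq I) (F : I -> T -> R) :
  (forall i, continuous (F i)) -> continuous (fun x => \sum_(i <- s) F i x).
Proof.
move=> cF x; apply: (cvg_big (op := +%R)) => [|i _]; first exact: add_continuous.
exact: cF.
Qed.

Lemma continuous_exp_sum (R : realType) (n : nat) (s : seq (R * 'rV[R]_n)) :
  continuous (exp_sum s).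
Proof.
apply: continuous_sum => p x.
apply (@continuousM R _ (cst p.1)); first exact: cst_continuous.
apply: continuous_comp; last exact: continuous_expR.
apply: continuous_sum => i y.
apply (@continuousM R _ (cst (p.2 ord0 i))); first exact: cst_continuous.
exact: coord_continuous.
Qed.

(** Some coordinate differs, and the exponential of that coordinate is a one-term sum. *)
Lemma exp_sum_separates (R : realType) (n : nat) (x y : 'rV[R]_n) :
  x <> y -> exists s : seq (R * 'rV[R]_n), exp_sum s x <> exp_sum s y.
Proof.
move=> xy.
have [i xyi] : exists i, x ord0 i <> y ord0 i.
  apply: contrapT => nxy; apply: xy; apply/rowP => i.
  by apply: contrapT => xyi; apply: nxy; exists i.
have dotE z : \sum_(j < n) (delta_mx 0 i : 'rV[R]_n) ord0 j * z ord0 j = z ord0 i.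
  rewrite (bigD1 i)//= big1 ?mxE ?eqxx ?mul1r ?addr0// => j ji.
  by rewrite mxE (negbTE ji) andbF mul0r.
exists [:: (1, delta_mx 0 i)].
by rewrite /exp_sum !big_seq1 /= !dotE !mul1r => /expR_inj.
Qed.

(** * From exponentials to Gaussians *)

Lemma euclid_norm_sqr (R : realType) (n : nat) (x : 'rV[R]_n) :
  euclid_norm x ^+ 2 = \sum_(i < n) x ord0 i ^+ 2.
Proof. by rewrite sqr_sqrtr// sumr_ge0// => i _; exact: sqr_ge0. Qed.

(** Completing the square in each coordinate. *)
Lemma gaussian_exp (R : realType) (n : nat) (x b : 'rV[R]_n) :
  expR (- euclid_norm x ^+ 2) * expR (\sum_(i < n) b ord0 i * x ord0 i) =
  expR (euclid_norm (2^-1 *: b) ^+ 2) *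
    expR (- euclid_norm (x - 2^-1 *: b) ^+ 2).
Proof.
rewrite -!expRD !euclid_norm_sqr -!sumrN -!big_split /=; congr expR.
by apply: eq_bigr => i _; rewrite !mxE; field.
Qed.

Lemma continuous_euclid_norm_sqr (R : realType) (n : nat) :
  continuous (fun x : 'rV[R]_n => euclid_norm x ^+ 2).
Proof.
rewrite (funext (@euclid_norm_sqr R n)).
apply: continuous_sum => i x.
by apply (@continuousM R); exact: coord_continuous.
Qed.

Theorem corollary5p2 (R : realType) (n : nat) (n_ge1 : (1 <= n)%N)
    (K : set 'rV[R]_n) (compactK : compact K)
    (eps : R) (eps_gt0 : 0 < eps)
    (f : 'rV[R]_n -> R) (contf : {within K, continuous f}) :
  exists (N : nat) (c : 'I_N -> R) (a : 'I_N -> 'rV[R]_n),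
    (1 <= N)%N /\
    sup_norm K (fun x : 'rV[R]_n =>
      f x - \sum_(j < N) c j * expR (- (euclid_norm (x - a j) ^+ 2))) < eps.
Proof.
pose F x := f x * expR (euclid_norm x ^+ 2).
have contF : {within K, continuous F}.
  apply/subspace_continuousP => x Kx; apply: cvgM.
    by move/subspace_continuousP: contf; exact.
  apply: continuous_cvg; first exact: continuous_expR.
  apply: cvg_within_filter; exact: continuous_euclid_norm_sqr.
have e2 : 0 < eps / 2 by lra.
have [_ [s0 _ <-] Fs0] : exists2 g, [set exp_sum s | s in setT] g &
    forall x, K x -> `|F x - g x| <= eps / 2.
  apply: (stone_weierstrass K _ compactK) => //.
  - move=> _ [s _ <-]; exact/continuous_subspaceT/continuous_exp_sum.
  - by move=> c; exists [:: (c, 0)] => //; apply/funext => x; rewrite exp_sum_cst.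
  - move=> _ _ [s _ <-] [t _ <-]; exists (s ++ t) => //.
    by apply/funext => x; rewrite exp_sumD.
  - move=> _ _ [s _ <-] [t _ <-].
    eexists; last by apply/funext => x; rewrite -exp_sumM.
    by [].
  - move=> x y _ _ /exp_sum_separates[s sxy].
    by exists (exp_sum s) => //; exists s.
(* The null term ensures that there is at least one Gaussian. *)
pose s := (0, 0) :: s0.
pose p := tnth (in_tuple s).
(* Each exponent vector [b] gives the centre [b / 2]; the constant from completing the square goes
   into the coefficient. *)
exists (size s), (fun j => (p j).1 * expR (euclid_norm (2^-1 *: (p j).2) ^+ 2)),
  (fun j => 2^-1 *: (p j).2); split=> //.
(* Pointwise bounds pass to the supremum only as a weak inequality, hence the margin. *)
apply: (@le_lt_trans _ _ (eps / 2)); last by lra.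
have [[x0 Kx0]|K0] := pselect (K !=set0); last first.
  rewrite /sup_norm (_ : [set _ | _ in _] = set0) ?sup0 ?ltW//.
  by apply/seteqP; split=> // y [x Kx _]; case: K0; exists x.
apply: ge_sup; first by eexists; exists x0.
move=> _ [x Kx <-].
rewrite [X in `|X|](_ : _ =
    expR (- euclid_norm x ^+ 2) * (F x - exp_sum s0 x)); last first.
  rewrite mulrBr /F mulrCA -expRD addNr expR0 mulr1; congr (_ - _).
  rewrite (_ : exp_sum s0 x = exp_sum s x); last first.
    by rewrite /exp_sum big_cons mul0r add0r.
  rewrite /exp_sum mulr_sumr [RHS]big_tnth; apply: eq_bigr => j _.
  by rewrite -mulrA [RHS]mulrCA gaussian_exp.
rewrite normrM (ger0_norm (expR_ge0 _)) -[leRHS]mul1r ler_pM ?expR_ge0 ?Fs0//.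
by rewrite -expR0 ler_expR oppr_le0 sqr_ge0.
Qed.
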